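(* Let $k\ge 1$ be an integer, let $\alpha\in[-1,0]$, and let $\mathcal{M}=z^kD_\alpha=\{z^kf: f\in D_\alpha\}$, equipped with the norm $\|\cdot\|_\alpha$ of $D_\alpha$. Then $z^k$ has the wandering subspace property in $\mathcal{M}$; that is, for every closed subspace $\mathcal{N}\subseteq\mathcal{M}$ with $z^k\mathcal{N}\subseteq\mathcal{N}$, $$\mathcal{N}=[\mathcal{N}\ominus z^k\mathcal{N}]_{z^k}.$$
   Context: Let $\mathbb{D}$ be the open unit disc in $\mathbb{C}$. For $\alpha\in\mathbb{R}$, $D_\alpha$ is the Hilbert space of analytic functions $f(z)=\sum_{j\ge0}a_jz^j$ on $\mathbb{D}$ with finite norm $\|f\|_\alpha=\left(\sum_{j\ge0}|a_j|^2(j+1)^\alpha\right)^{1/2}$, with the corresponding inner product. For a subset $\mathcal{K}\subseteq D_\alpha$, $[\mathcal{K}]_{z^k}$ denotes the smallest closed subspace containing $\mathcal{K}$ and invariant under multiplication by $z^k$. $\mathcal{N}\ominus z^k\mathcal{N}$ is the set of elements of $\mathcal{N}$ orthogonal to $z^k\mathcal{N}$. *)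

(* Defs.v *)
From HB Require Import structures.
From mathcomp Require Import all_boot all_order all_algebra.
From mathcomp Require Import all_classical all_reals all_analysis.
From mathcomp Require Import complex.

Set Implicit Arguments.
Unset Strict Implicit.
Unset Printing Implicit Defensive.

Import Order.TTheory GRing.Theory Num.Theory numFieldNormedType.Exports.

Local Open Scope classical_set_scope.
Local Open Scope ring_scope.

(* R[i] carries no topology of its own in the library; naming it as a
   numClosedFieldType makes the norm topology of numFieldNormedType, and the
   conjugation of numClosedFieldType, available on it. *)
Definition Cplx (R : realType) : numClosedFieldType := R[i]%C.

Definition disc (R : realType) : set (Cplx R) := [set z | `|z| < 1].
Arguments disc R : clear implicits.

(* Functions on the disc, not on the whole plane, so that equality of elements
   of the space is equality on the disc. The C-vector space structure is the
   pointwise one. *)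
Notation discfun R := (set_type (disc R) -> Cplx R).

Definition is_taylor (R : realType) (f : discfun R) (a : nat -> Cplx R) :=
  forall z : disc R,
    series (fun j => a j * \val z ^+ j) @ \oo --> f z.

Definition analytic (R : realType) (f : discfun R) := exists a, is_taylor f a.

(* Coefficients of the (unique) power series expansion; junk value 0 when f is
   not analytic. *)
Definition taylor (R : realType) (f : discfun R) : nat -> Cplx R :=
  xget (fun=> 0) [set a | is_taylor f a].

Definition weight (R : realType) (alpha : R) (j : nat) : R :=
  (j.+1%:R `^ alpha)%R.

Definition sqnormD (R : realType) (alpha : R) (f : discfun R) : \bar R :=
  (\sum_(0 <= j <oo) (Normc.normc (taylor f j) ^+ 2 * weight alpha j)%:E)%E.

Definition spaceD (R : realType) (alpha : R) : set (discfun R) :=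
  [set f | analytic f /\ (sqnormD alpha f < +oo)%E].

Definition normD (R : realType) (alpha : R) (f : discfun R) : R :=
  Num.sqrt (fine (sqnormD alpha f)).

Definition innerD (R : realType) (alpha : R) (f g : discfun R) : Cplx R :=
  limn (series (fun j =>
    taylor f j * (taylor g j)^* * ((weight alpha j)%:C)%C) : nat -> Cplx R).

Definition mulz (R : realType) (k : nat) (f : discfun R) : discfun R :=
  fun z => \val z ^+ k * f z.

Definition linear_subspace (R : realType) (N : set (discfun R)) :=
  N (fun=> 0) /\
  forall (c : Cplx R) (f g : discfun R), N f -> N g -> N (c *: f + g).

(* Closedness is with respect to the norm of the space, not to a topology on
   the type of all functions on the disc. *)
Definition closed_subspace (R : realType) (alpha : R) (N : set (discfun R)) :=
  [/\ N `<=` spaceD alpha,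
      linear_subspace N &
      forall f, spaceD alpha f ->
        (forall e : R, 0 < e -> exists2 g, N g & normD alpha (f - g) < e) ->
        N f].

Definition invariant (R : realType) (k : nat) (N : set (discfun R)) :=
  mulz k @` N `<=` N.

Definition inv_span (R : realType) (alpha : R) (k : nat)
    (K : set (discfun R)) : set (discfun R) :=
  smallest [set N | closed_subspace alpha N /\ invariant k N] K.

Definition ominus (R : realType) (alpha : R) (N L : set (discfun R)) :
    set (discfun R) :=
  [set f | N f /\ forall g, L g -> innerD alpha f g = 0].

Definition wandering_subspace_property (R : realType) (alpha : R) (k : nat)
    (M : set (discfun R)) :=
  forall N : set (discfun R),
    closed_subspace alpha N -> N `<=` M -> invariant k N ->
    N = inv_span alpha k (ominus alpha N (mulz k @` N)).

(* Main.v *)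
Require Import Defs.
From HB Require Import structures.
From mathcomp Require Import all_boot all_order all_algebra.
From mathcomp Require Import all_classical all_reals all_analysis.
From mathcomp Require Import complex.
From mathcomp Require Import ring lra zify.

(* Following Shimorin, the weighted shift T = z^k satisfies
     |T f + g|^2 <= 2 (|f|^2 + |T g|^2)   for all f, g in z^k D_alpha.
   Coefficientwise this is the concavity of j |-> 1 / w_j = (j + 1)^(-alpha),
   used at the indices j - k, j, j + k; an element of z^k D_alpha has no
   coefficient of index j < k, where this argument is not available.
   Let N' be any closed invariant subspace containing N (-) T N, and let y in N
   be orthogonal to the intersection of N and N'.  Let S be the adjoint of T in N.
   Every S^i y is orthogonal to N (-) T N, hence lies in the closed space T N.
   The inequality then makes |S^i y|^2 a concave sequence.  It is nonnegative,
   and nonincreasing because T is a contraction, so it is constant; this forces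
   T (S^(i+1) y) = S^i y.  Thus y = T^n (S^n y) for all n, so y vanishes at 0 to
   infinite order and y = 0. *)

Set Implicit Arguments.
Unset Strict Implicit.
Unset Printing Implicit Defensive.

Import Order.TTheory GRing.Theory Num.Theory numFieldNormedType.Exports.
Local Open Scope classical_set_scope.
Local Open Scope ring_scope.

(** * Shimorin's argument in a real Hilbert space *)

Section HilbertSpace.
Variables (R : realType) (V : lmodType R) (ip : V -> V -> R).
Hypothesis ipC : forall x y, ip x y = ip y x.
Hypothesis ipDl : forall x y z, ip (x + y) z = ip x z + ip y z.
Hypothesis ipZl : forall c x z, ip (c *: x) z = c * ip x z.
Hypothesis ip_ge0 : forall x, 0 <= ip x x.
Hypothesis ip_eq0 : forall x, ip x x = 0 -> x = 0.
Hypothesis ip_complete : forall u : nat -> V,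
  (forall e, 0 < e -> exists n, forall i j, (n <= i)%N -> (n <= j)%N ->
     ip (u i - u j) (u i - u j) < e) ->
  exists l, forall e, 0 < e -> exists n, forall i, (n <= i)%N ->
    ip (u i - l) (u i - l) < e.

Definition subspace (N : set V) :=
  N 0 /\ forall c f g, N f -> N g -> N (c *: f + g).

Definition ip_closed (N : set V) := forall f,
  (forall e, 0 < e -> exists2 g, N g & ip (f - g) (f - g) < e) -> N f.

Lemma ipDr x y z : ip x (y + z) = ip x y + ip x z.
Proof. by rewrite ipC ipDl !(ipC x). Qed.

Lemma ipZr c x z : ip x (c *: z) = c * ip x z.
Proof. by rewrite ipC ipZl ipC. Qed.

Lemma ipNl x z : ip (- x) z = - ip x z.
Proof. by rewrite -scaleN1r ipZl mulN1r. Qed.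

Lemma ipNr x z : ip x (- z) = - ip x z.
Proof. by rewrite ipC ipNl ipC. Qed.

Let ipE := (ipDl, ipDr, ipNl, ipNr, ipZl, ipZr).

(** When [ip y y] is positive, expand the square of [ip y y *: x - ip x y *: y]; otherwise [y = 0]
    by definiteness. *)
Lemma ip_cauchy_schwarz x y : ip x y ^+ 2 <= ip x x * ip y y.
Proof.
have [/ip_eq0 ->|y_neq0] := eqVneq (ip y y) 0.
  by rewrite -(scale0r x) !ipE; nra.
have y_gt0 : 0 < ip y y by rewrite lt_def y_neq0 ip_ge0.
have := ip_ge0 (ip y y *: x - ip x y *: y).
rewrite !ipE (ipC y x).
move: y_gt0; move: (ip x x) (ip x y) (ip y y) => a b c; nra.
Qed.

(* A minimizing sequence of [ip f f - 2 * phi f] over N is Cauchy by the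
   parallelogram law, and its limit represents phi. *)
Lemma riesz (N : set V) (phi : V -> R) (C : R) :
  subspace N -> ip_closed N -> 0 <= C ->
  (forall c f g, phi (c *: f + g) = c * phi f + phi g) ->
  (forall f, phi f ^+ 2 <= C * ip f f) ->
  exists2 p, N p & forall d, N d -> ip p d = phi d.
Proof.
move=> [N0 Nlin] Ncl C0 phil phib.
pose J f := ip f f - 2 * phi f.
(* With q = [ip f f], [J f] is at least q - 2 sqrt(C q) >= - C; the square root is avoided by
   squaring q + C < 2 t. *)
have J_lb : has_lbound (J @` N).
  exists (- C) => _ [f _ <-]; rewrite /J.
  have := phib f; have := ip_ge0 f.
  move: (ip f f) (phi f) => q t q0 tq; rewrite leNgt; apply/negP => lt.
  have := sqr_ge0 (q - C).
  have : (q + C) * (q + C) < (2 * t) * (2 * t) by apply: ltr_pM; lra.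
  nra.
have J_inf : has_inf (J @` N) by split=> //; exists (J 0); exists 0.
have J_ge f : N f -> inf (J @` N) <= J f by move=> Nf; apply: ge_inf => //; exists f.
set m := inf _ in J_ge.
have /choice[y yP] : forall n : nat, exists f, N f /\ J f < m + n.+1%:R^-1.
  move=> n; have n0 : 0 < (n.+1%:R^-1 : R) by rewrite invr_gt0.
  by have [_ [f Nf <-] fm] := inf_adherent n0 J_inf; exists f.
have small e : 0 < e -> exists n, forall i, (n <= i)%N -> J (y i) < m + e.
  move=> e0; exists (Num.truncn e^-1).+1 => i ni.
  have [_ /lt_trans] := yP i; apply; rewrite ltrD2l invf_plt ?posrE //.
  by apply: lt_trans (truncnS_gt _) _; rewrite ltr_nat ltnS.
have [p pP] : exists l, forall e, 0 < e -> exists n, forall i, (n <= i)%N ->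
    ip (y i - l) (y i - l) < e.
  (* |y_i - y_j|^2 = 2 J(y_i) + 2 J(y_j) - 4 J((y_i + y_j) / 2), and J >= m at the midpoint, so two
     excesses below e / 4 give a total below e. *)
  apply: ip_complete => e e0; have [|n nP] := small (e / 4); first lra.
  exists n => i j /nP yi /nP yj.
  have Nm : N (2^-1 *: (y i) + (2^-1 *: (y j) + 0)).
    by apply: (Nlin _ _ _ (yP i).1); apply: (Nlin _ _ _ (yP j).1).
  have := J_ge _ Nm; move: yi yj.
  have phi0 : phi 0 = 0 by have := phil (-1) 0 0; rewrite scaler0 addr0; lra.
  rewrite addr0 /J phil -[2^-1 *: y j]addr0 phil phi0 addr0 !ipE (ipC (y j) (y i)).
  lra.
exists p.
  apply: Ncl => e e0; have [n nP] := pP e e0; exists (y n); first exact: (yP n).1.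
  by rewrite -opprB ipNl ipNr opprK nP.
move=> d Nd.
(* Near-minimality at a late term [u] gives 2 t (ip u d - phi d) + t^2 |d|^2 > - e. Replacing [u] by
   [p] costs at most e + t^2 |d|^2 more; halving yields the claim up to e. *)
have key t : 0 <= t * (ip p d - phi d) + t ^+ 2 * ip d d.
  apply/ler_addgt0Pr => e e0.
  have [n1 n1P] := pP _ e0; have [n2 n2P] := small _ e0.
  have {n1P}  := n1P _ (leq_maxl n1 n2); have {n2P}  := n2P _ (leq_maxr n1 n2).
  set u := y _ => Ju pu.
  have := J_ge _ (Nlin t _ _ Nd (yP (maxn n1 n2)).1); rewrite -/u => Jm.
  have := ip_ge0 ((u - p) - t *: d).
  move: Ju pu Jm; rewrite /J phil !ipE (ipC d u) (ipC p u) (ipC d p).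
  move: (ip u d) (ip p d) (ip u u) (ip u p) (ip p p) (ip d d) (phi d) (phi u) => *.
  nra.
have d0 := ip_ge0 d; have dd : 0 < ip d d + 1 by lra.
(* This t turns the expression into minus a square; the added 1 spares the case [d = 0]. *)
have := key (- (ip p d - phi d) / (ip d d + 1)).
set a := ip p d - phi d; set q := ip d d in dd d0 *.
have -> : - a / (q + 1) * a + (- a / (q + 1)) ^+ 2 * q = - (a / (q + 1)) ^+ 2.
  by field; lra.
rewrite oppr_ge0 => h; have /eqP : (a / (q + 1)) ^+ 2 = 0.
  by apply/eqP; rewrite eq_le h sqr_ge0.
by rewrite sqrf_eq0 mulf_eq0 invr_eq0 (gt_eqF dd) orbF subr_eq0 => /eqP.
Qed.

(** By concavity the decrements are nondecreasing, so a positive one would persist and drive the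
    sequence below zero. *)
Lemma concave_nonincreasing_const (a : nat -> R) :
  (forall i, 0 <= a i) -> (forall i, a i.+1 <= a i) ->
  (forall i, a i + a i.+2 <= 2 * a i.+1) -> forall i, a i.+1 = a i.
Proof.
move=> a_ge0 a_noninc a_conc i; apply/eqP; rewrite eq_le a_noninc /=.
have step n : a i - a i.+1 <= a (i + n)%N - a (i + n).+1.
  elim: n => [|n IH]; first by rewrite addn0.
  by rewrite addnS; have := a_conc (i + n)%N; lra.
have lin n : n%:R * (a i - a i.+1) <= a i - a (i + n)%N.
  elim: n => [|n IH]; first by rewrite addn0 mul0r subrr.
  by rewrite addnS -natr1 mulrDl mul1r; have := step n; lra.
rewrite leNgt; apply/negP => lt.
have d0 : 0 < a i - a i.+1 by lra.
have := lin (Num.truncn (a i / (a i - a i.+1))).+1.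
have := truncnS_gt (a i / (a i - a i.+1)).
rewrite ltr_pdivrMr //; have := a_ge0 (i + (Num.truncn (a i / (a i - a i.+1))).+1)%N.
lra.
Qed.


(** [N'] is any closed invariant subspace containing the wandering part of [N]. The hypothesis on
    [iter n T g] is purity: no nonzero element of [N] is divisible by every power of [T]. *)
Lemma wandering_subspace_of_shimorin (T : V -> V) (N N' : set V) :
  (forall c f g, T (c *: f + g) = c *: T f + T g) ->
  (forall f, ip (T f) (T f) <= ip f f) ->
  subspace N -> ip_closed N -> (forall f, N f -> N (T f)) ->
  subspace N' -> ip_closed N' -> (forall f, N' f -> N' (T f)) ->
  (forall f g, N f -> N g ->
     ip (T f + g) (T f + g) <= 2 * (ip f f + ip (T g) (T g))) ->
  (forall f, N f -> (forall n, exists g, f = iter n T g) -> f = 0) ->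
  (forall e, N e -> (forall g, N g -> ip e (T g) = 0) -> N' e) ->
  N `<=` N'.
Proof.
move=> Tlin Tcontr [N0 Nlin] Ncl NT [N'0 N'lin] N'cl N'T shim pure EN'.
have sub0 f g : N f -> N g -> N (f - g).
  by move=> Nf Ng; rewrite -scaleN1r addrC; apply: Nlin.
have ip_continuous z f : ip z f ^+ 2 <= ip z z * ip f f.
  exact: ip_cauchy_schwarz.
have ip_lin z c f g : ip z (c *: f + g) = c * ip z f + ip z g.
  by rewrite ipDr ipZr.
have T0 : T 0 = 0.
  by rewrite -[in LHS](subrr 0) -scaleN1r addrC Tlin scaleN1r addNr.
have TB f g : T (f - g) = T f - T g.
  by rewrite -scaleN1r addrC Tlin scaleN1r addrC.
(* Shimorin's inequality with first argument 0 reads |g|^2 <= 2 |T g|^2 on [N], so a sequence in [N]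
   is Cauchy as soon as its image under [T] is. *)
have TN_closed : ip_closed (T @` N).
  move=> f fN.
  have /choice[g gP] : forall n : nat,
      exists g, N g /\ ip (f - T g) (f - T g) < n.+1%:R^-1.
    move=> n; have [|_ [g Ng <-] lt] := fN n.+1%:R^-1; first by rewrite invr_gt0.
    by exists g.
  have small e : 0 < e -> exists n, forall i, (n <= i)%N ->
      ip (f - T (g i)) (f - T (g i)) < e.
    move=> e0; exists (Num.truncn e^-1).+1 => i ni.
    have [_ /lt_trans] := gP i; apply; rewrite invf_plt ?posrE //.
    by apply: lt_trans (truncnS_gt _) _; rewrite ltr_nat ltnS.
  have [h hP] : exists l, forall e, 0 < e -> exists n, forall i, (n <= i)%N ->
      ip (g i - l) (g i - l) < e.
    apply: ip_complete => e e0; have [|n nP] := small (e / 8); first lra.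
    exists n => i j /nP gi /nP gj.
    have := shim _ _ N0 (sub0 _ _ (gP i).1 (gP j).1).
    have := ip_ge0 ((f - T (g i)) + (f - T (g j))).
    rewrite T0 add0r TB; move: gi gj; rewrite !ipE !(ipC _ f) (ipC (T (g j)) (T (g i))).
    rewrite (_ : ip 0 0 = 0); last by rewrite -(scale0r 0) ipZl mul0r.
    lra.
  exists h.
    apply: Ncl => e e0; have [n nP] := hP _ e0; exists (g n); first exact: (gP n).1.
    by rewrite -opprB ipNl ipNr opprK nP.
  apply/esym/eqP; rewrite -subr_eq0; apply/eqP/ip_eq0/eqP.
  rewrite eq_le ip_ge0 andbT; apply/ler_addgt0Pr => e e0; rewrite add0r.
  have [|n1 n1P] := hP (e / 4); first lra.
  have [|n2 n2P] := small (e / 4); first lra.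
  have {n1P} gh := n1P _ (leq_maxl n1 n2).
  have {n2P} fg := n2P _ (leq_maxr n1 n2).
  set u := g _ in gh fg.
  have := Tcontr (u - h).
  have := ip_ge0 ((f - T u) - (T u - T h)).
  move: gh fg; rewrite TB !ipE !(ipC _ f) (ipC (T h) (T u)); lra.
move=> x Nx.
pose N2 := N `&` N'.
have N2sub : subspace N2.
  by split=> [|c f g [? ?] [? ?]]; split=> //; [exact: Nlin | exact: N'lin].
have N2cl : ip_closed N2.
  move=> f fN; split; [apply: Ncl|apply: N'cl] => e /fN[g [Ng N'g] ge]; by exists g.
(* [p] is the orthogonal projection of [x] on the intersection [N2]; the goal becomes
   [x - p = 0]. *)
have [p [Np N'p] pP] := riesz N2sub N2cl (ip_ge0 x)
  (ip_lin x) (ip_continuous x).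
have y_perp f : N2 f -> ip (x - p) f = 0.
  by move=> /pP; rewrite ipDl ipNl => ->; rewrite subrr.
(* [S0] is the adjoint of [T] relative to [N], obtained from Riesz; contractivity of [T] bounds the
   functional. *)
have /choice[S0 S0P] : forall z, exists s, N s /\ forall f, N f -> ip s f = ip z (T f).
  move=> z; have [s Ns sP] := @riesz N (fun f => ip z (T f)) (ip z z)
    (conj N0 Nlin) Ncl (ip_ge0 z)
    (fun c f g => etrans (congr1 (ip z) (Tlin c f g)) (ip_lin z c (T f) (T g)))
    (fun f => le_trans (ip_cauchy_schwarz z (T f)) (ler_wpM2l (ip_ge0 z) (Tcontr f))).
  by exists s.
have SN z : N (S0 z) by have [] := S0P z.
have Sadj z f : N f -> ip (S0 z) f = ip z (T f) by move=> Nf; have [_ ->] := S0P z.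
pose y i := iter i S0 (x - p).
have yN i : N (y i) by case: i => [|i]; [exact: sub0 | exact: SN].
(* [N2] is invariant under [T], so the adjoint preserves orthogonality to it. *)
have yperp i f : N2 f -> ip (y i) f = 0.
  elim: i f => [|i IH] f; first exact: y_perp.
  move=> [Nf N'f]; rewrite Sadj //; apply: IH; split; [exact: NT|exact: N'T].
(* Project [y i] to [T u] in the closed space T N. The remainder is orthogonal to T N, hence lies in
   [N2] and is orthogonal to [y i] too; it is therefore orthogonal to itself. *)
have yT i : exists2 u, N u & y i = T u.
  have TNsub : subspace (T @` N).
    split=> [|c _ _ [f Nf <-] [g Ng <-]]; first by exists 0.
    by exists (c *: f + g); [exact: Nlin | rewrite Tlin].
  have [_ [u Nu <-] uP] := riesz TNsub TN_closed (ip_ge0 (y i))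
    (ip_lin (y i)) (ip_continuous (y i)).
  exists u => //.
  have Ne : N (y i - T u) by apply: sub0 => //; apply: NT.
  have eT f : N f -> ip (y i - T u) (T f) = 0.
    by move=> Nf; rewrite ipDl ipNl uP ?subrr //; exists f.
  have := yperp i _ (conj Ne (EN' _ Ne eT)).
  have := eT _ Nu; rewrite ipC => h2 h1.
  apply/eqP; rewrite -subr_eq0; apply/eqP/ip_eq0.
  by rewrite {1}[y i - T u]lock ipDr -lock ipNr (ipC _ (y i)) h1 ipC h2 subrr.
(* Pair T f + g with y_(i+1) for f = y_(i+2) and g = u, where T u = y_i. *)
have S_conc i : ip (y i) (y i) + ip (y i.+2) (y i.+2) <= 2 * ip (y i.+1) (y i.+1).
  have [u Nu yu] := yT i.
  have yu' : ip (y i.+1) u = ip (y i) (y i) by rewrite {2}yu -(Sadj (y i)).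
  have yy : ip (y i.+1) (T (y i.+2)) = ip (y i.+2) (y i.+2).
    exact: esym (Sadj (y i.+1) _ (yN i.+2)).
  have := ip_cauchy_schwarz (T (y i.+2) + u) (y i.+1).
  rewrite [ip (_ + u) (y i.+1)]ipDl (ipC (T _) (y i.+1)) (ipC u (y i.+1)) yy yu'.
  have := shim _ _ (yN i.+2) Nu; rewrite -yu.
  have := ip_ge0 (y i); have := ip_ge0 (y i.+1); have := ip_ge0 (y i.+2).
  move: (ip (y i) _) (ip (y i.+1) _) (ip (y i.+2) _) (ip (_ + u) _) => a b c d.
  move=> c0 b0 a0 dle sq.
  (* [sq] and [dle] give (a + c)^2 <= 2 (a + c) b; cancel a + c unless it vanishes. *)
  have [ac|ac] := ltP 0 (a + c); last lra.
  rewrite -(ler_pM2r ac); nra.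
have S_contr i : ip (y i.+1) (y i.+1) <= ip (y i) (y i).
  have := ip_cauchy_schwarz (y i) (T (y i.+1)).
  rewrite -Sadj // -[S0 _]/(y i.+1).
  have := Tcontr (y i.+1); have := ip_ge0 (y i); have := ip_ge0 (y i.+1).
  move: (ip (y i) _) (ip (y i.+1) _) (ip (T _) _) => a b c b0 a0 cb sq.
  have [b_gt0|] := ltP 0 b; last lra.
  rewrite -(ler_pM2r b_gt0); nra.
have y_const := concave_nonincreasing_const (fun i => ip_ge0 (y i)) S_contr S_conc.
(* |y_i - T y_(i+1)|^2 = |y_i|^2 - 2 |y_(i+1)|^2 + |T y_(i+1)|^2, which is at most |y_i|^2 -
   |y_(i+1)|^2 = 0. *)
have yTS i : y i = T (y i.+1).
  apply/eqP; rewrite -subr_eq0; apply/eqP/ip_eq0/eqP; rewrite eq_le ip_ge0 andbT.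
  rewrite !ipE (ipC (T _) (y i)) -Sadj // -[S0 _]/(y i.+1).
  have := Tcontr (y i.+1); have := y_const i; lra.
have y_iter n : x - p = iter n T (y n).
  by elim: n => [//|n IH]; rewrite IH iterSr -yTS.
have /eqP : x - p = 0.
  by apply: pure => [|n]; [exact: sub0 | exists (y n)].
by rewrite subr_eq0 => /eqP ->.
Qed.
End HilbertSpace.

(** * Shifts on weighted l2 spaces *)

Section WeightedL2.
Variables (R : realType) (v : nat -> {posnum R}).
Implicit Types c d : nat -> R.

Definition wsum c : nat -> R := series (fun j => c j ^+ 2 * (v j)%:num).

(** Membership is a bound on partial sums, which passes directly to combinations, shifts and
    coordinatewise limits. *)
Definition l2_pred : {pred nat -> R} :=
  fun c => `[< exists B, forall n, wsum c n <= B >].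

Lemma wsum_nondecreasing c : nondecreasing_seq (wsum c).
Proof.
by apply: nondecreasing_series => n _ _; rewrite mulr_ge0 // sqr_ge0.
Qed.

Lemma wsum_ge0 c n : 0 <= wsum c n.
Proof. by rewrite sumr_ge0 // => n' _; rewrite mulr_ge0 // sqr_ge0. Qed.

Lemma wsum_comb a c d n :
  wsum (a *: c + d) n <= 2 * (a ^+ 2 * wsum c n + wsum d n).
Proof.
rewrite /wsum /series /= mulr_sumr -big_split mulr_sumr; apply: ler_sum => j _ /=.
rewrite mulrA -mulrDl [leRHS]mulrA ler_wpM2r // !fctE.
change (a *: c j) with (a * c j).
have := sqr_ge0 (a * c j - d j); lra.
Qed.

Lemma l2_submod_closed : submod_closed l2_pred.
Proof.
split=> [|a c d /asboolP[B cB] /asboolP[D dD]].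
  apply/asboolP; exists 0 => n; rewrite /wsum /series /= big1 // => j _.
  by rewrite expr0n mul0r.
apply/asboolP; exists (2 * (a ^+ 2 * B + D)) => n.
apply: le_trans (wsum_comb _ _ _ _) _.
by rewrite ler_wpM2l // lerD // ler_wpM2l // sqr_ge0.
Qed.

HB.instance Definition _ :=
  GRing.isSubmodClosed.Build R (nat -> R) l2_pred l2_submod_closed.

Record l2 := L2 { l2_val :> nat -> R; _ : l2_val \in l2_pred }.
HB.instance Definition _ := [isSub for l2_val].
HB.instance Definition _ := [Choice of l2 by <:].
HB.instance Definition _ := [SubChoice_isSubLmodule of l2 by <:].

Lemma l2P (c : l2) : exists B, forall n, wsum c n <= B.
Proof. by case: c => c /= /asboolP. Qed.

Definition l2_ip (c d : l2) : R := limn (series (fun j => c j * d j * (v j)%:num)).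

Lemma wsum_cvg (c : l2) : cvgn (wsum c).
Proof.
have [B cB] := l2P c; apply: nondecreasing_is_cvgn (wsum_nondecreasing c) _.
by exists B => _ [n _ <-].
Qed.

Lemma l2_ip_cvg (c d : l2) : cvgn (series (fun j => c j * d j * (v j)%:num)).
Proof.
apply: normed_cvg; apply: (@series_le_cvg _ _
  ((fun j => c j ^+ 2 * (v j)%:num) + (fun j => d j ^+ 2 * (v j)%:num))) => [j|j|j|].
- exact: normr_ge0.
- by rewrite !fctE addr_ge0 // mulr_ge0 // sqr_ge0.
- rewrite /= normrM (ger0_norm (ltW (gt0 (v j)))) !fctE -mulrDl ler_wpM2r //.
  rewrite ler_norml; have := sqr_ge0 (c j + d j); have := sqr_ge0 (c j - d j); nra.
- by apply: is_cvg_seriesD; exact: wsum_cvg.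
Qed.

Lemma l2_ipC (c d : l2) : l2_ip c d = l2_ip d c.
Proof. by rewrite /l2_ip; under eq_fun do rewrite (mulrC (c _)). Qed.

Lemma l2_ipDl (c d e : l2) : l2_ip (c + d) e = l2_ip c e + l2_ip d e.
Proof.
rewrite /l2_ip -limD; [|exact: l2_ip_cvg|exact: l2_ip_cvg].
congr (limn _); rewrite -seriesD; congr series.
by apply/funext => j /=; rewrite !fctE; ring.
Qed.

Lemma l2_ipZl a (c e : l2) : l2_ip (a *: c) e = a * l2_ip c e.
Proof.
rewrite /l2_ip -[RHS]/(a *: limn _) -limZr; last exact: l2_ip_cvg.
congr (limn _); rewrite -[RHS]/(a *: series _) -seriesZ; congr series.
by apply/funext => j /=; rewrite !fctE -[(a *: c j) in LHS]/(a * c j)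
  -[RHS]/(a * (c j * e j * _)); ring.
Qed.

Lemma wsum_le_l2_ip (c : l2) n : wsum c n <= l2_ip c c.
Proof. exact: nondecreasing_cvgn_le (wsum_nondecreasing c) (@wsum_cvg c) n. Qed.

Lemma l2_ip_le (c : l2) B : (forall n, wsum c n <= B) -> l2_ip c c <= B.
Proof. by move=> cB; apply: limr_le (@wsum_cvg c) _; apply: nearW. Qed.

Lemma l2_ip_ge0 (c : l2) : 0 <= l2_ip c c.
Proof. exact: le_trans (wsum_ge0 c 0) (wsum_le_l2_ip c 0). Qed.

Lemma coord_le_l2_ip (c : l2) j : c j ^+ 2 * (v j)%:num <= l2_ip c c.
Proof.
apply: le_trans (wsum_le_l2_ip c j.+1); rewrite /wsum seriesSr.
by rewrite lerDr; exact: wsum_ge0.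
Qed.

Lemma l2_ip_eq0 (c : l2) : l2_ip c c = 0 -> c = 0.
Proof.
move=> c0; apply/val_inj/funext => j /=.
have := coord_le_l2_ip c j; rewrite c0 pmulr_lle0 // => cj.
by apply/eqP; rewrite -sqrf_eq0 eq_le cj sqr_ge0.
Qed.

Lemma cvg_wsum (u : nat -> nat -> R) l n :
  (forall k, u i k @[i --> \oo] --> l k) -> wsum (u i) n @[i --> \oo] --> wsum l n.
Proof.
move=> ul; elim: n => [|n IH].
  by rewrite /wsum; under eq_fun do rewrite /series /= big_nil;
     rewrite /series /= big_nil; exact: cvg_cst.
rewrite /wsum; under eq_fun do rewrite seriesSr; rewrite seriesSr.
by apply: cvgD => //; apply: cvgMl; rewrite expr2; under eq_fun do rewrite expr2; apply: cvgM.
Qed.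

Lemma l2_complete (u : nat -> l2) :
  (forall e, 0 < e -> exists n, forall i j, (n <= i)%N -> (n <= j)%N ->
     l2_ip (u i - u j) (u i - u j) < e) ->
  exists l, forall e, 0 < e -> exists n, forall i, (n <= i)%N ->
    l2_ip (u i - l) (u i - l) < e.
Proof.
move=> uC.
have coord_cvg k : cvgn (fun i => u i k).
  apply/cauchy_cvgP/cauchy_exP => e e0.
  have [|n nP] := uC (e ^+ 2 * (v k)%:num); first by rewrite mulr_gt0 // exprn_gt0.
  exists (u n k); exists n => // i /= ni.
  have := le_lt_trans (coord_le_l2_ip _ k) (nP n i (leqnn n) ni).
  rewrite ltr_pM2r // -ball_normE /ball_ /= -(real_normK (num_real ((u n - u i) k))).
  by rewrite ltr_pXn2r ?nnegrE ?normr_ge0 ?(ltW e0).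
pose l k := limn (fun i => u i k).
(* The limit is taken in a partial sum of fixed length [N], with a bound independent of [N]. *)
have tail e : 0 < e -> exists n, forall i N, (n <= i)%N -> wsum (\val (u i) - l) N <= e.
  move=> e0; have [n nP] := uC e e0; exists n => i N ni.
  have cv : wsum (\val (u i) - \val (u m)) N @[m --> \oo] --> wsum (\val (u i) - l) N.
    apply: cvg_wsum => k; rewrite !fctE; apply: cvgB; first exact: cvg_cst.
    exact: coord_cvg.
  rewrite -(cvg_lim _ cv) //; apply: limr_le; first by apply/cvg_ex; eexists; exact: cv.
  exists n => // m /= nm.
  exact: le_trans (wsum_le_l2_ip (u i - u m) N) (ltW (nP i m ni nm)).
have [n nP] := tail 1 ltr01.
have dl2 : \val (u n) - l \in l2_pred.
  by apply/asboolP; exists 1 => N; exact: nP.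
(* Coordinatewise this is [l]; it is written so because square summability is known for
   [u n - l]. *)
exists (u n - L2 dl2) => e e0; have [|m mP] := tail (e / 2); first lra.
exists m => i mi; apply: (@le_lt_trans _ _ (e / 2)); last lra.
apply: l2_ip_le => N; rewrite (_ : l2_val _ = \val (u i) - l); first exact: mP.
by apply/funext => k; rewrite /= !fctE; ring.
Qed.

(** * The shift by [m] places and Shimorin's inequality for it *)

Section Shift.
Variable m : nat.
Hypothesis v_noninc : forall j, (v (j + m)%N)%:num <= (v j)%:num.

Definition shift (c : nat -> R) j : R := if (j < m)%N then 0 else c (j - m)%N.

Lemma series_shift (f : nat -> R) n :
  series (fun j => if (j < m)%N then 0 else f (j - m)%N) (n + m)%N = series f n.
Proof.
elim: n => [|n IH].
  rewrite add0n /series /= big_nil big_nat big1 // => j /andP[_ ->] //.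
by rewrite addSn !seriesSr IH ltnNge leq_addl /= addnK.
Qed.

Lemma wsum_shift c n :
  wsum (shift c) (n + m) = series (fun j => c j ^+ 2 * (v (j + m)%N)%:num) n.
Proof.
rewrite -series_shift /wsum; congr (series _ _); apply/funext => j; rewrite /shift.
by case: ltnP => [|mj]; rewrite ?expr0n ?mul0r // subnK.
Qed.

Lemma wsum_shift_le c n : wsum (shift c) n <= wsum c n.
Proof.
apply: le_trans (wsum_nondecreasing _ (leq_addr m n)) _; rewrite wsum_shift.
by apply: ler_sum => j _; rewrite ler_wpM2l // sqr_ge0.
Qed.

Lemma shift_l2 (c : l2) : shift c \in l2_pred.
Proof.
have [B cB] := l2P c; apply/asboolP; exists B => n.
exact: le_trans (wsum_shift_le _ _) (cB n).
Qed.

Definition l2shift (c : l2) : l2 := L2 (shift_l2 c).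

Lemma l2shift_linear a (c d : l2) : l2shift (a *: c + d) = a *: l2shift c + l2shift d.
Proof.
apply/val_inj/funext => j; rewrite /= /shift !fctE /=.
by rewrite /shift; case: ltnP => // _; rewrite scaler0 addr0.
Qed.

Hypothesis m_gt0 : (0 < m)%N.
Hypothesis v_conc : forall j,
  (v j)%:num^-1 + (v (j + m + m)%N)%:num^-1 <= 2 * (v (j + m)%N)%:num^-1.

(** Cauchy-Schwarz gives (x + y)^2 <= (x^2 a + y^2 c) (1/a + 1/c), and b (1/a + 1/c) <= 2. *)
Lemma weighted_parallelogram (a b c x y : R) : 0 < a -> 0 < b -> 0 < c ->
  a^-1 + c^-1 <= 2 * b^-1 ->
  (x + y) ^+ 2 * b <= 2 * (x ^+ 2 * a + y ^+ 2 * c).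
Proof.
move=> a0 b0 c0 conc.
have bac : b * (a^-1 + c^-1) <= 2.
  by rewrite -ler_pdivlMl // mulrC.
have sq : (x + y) ^+ 2 <= (x ^+ 2 * a + y ^+ 2 * c) * (a^-1 + c^-1).
  rewrite -subr_ge0 (_ : _ - _ = (a * x - c * y) ^+ 2 / (a * c)).
    by rewrite mulr_ge0 ?sqr_ge0 // invr_ge0 mulr_ge0 // ltW.
  by field; rewrite !gt_eqF.
have q0 : 0 <= x ^+ 2 * a + y ^+ 2 * c.
  by rewrite addr_ge0 // mulr_ge0 ?sqr_ge0 // ltW.
have := ler_wpM2r (ltW b0) sq; have := ler_wpM2l q0 bac; lra.
Qed.

(** At an index j >= m, apply [weighted_parallelogram] with the weights at j - m, j and j + m; below
    [m] both sequences vanish. *)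
Lemma l2shift_shimorin (c d : l2) : (forall j, (j < m)%N -> d j = 0) ->
  l2_ip (l2shift c + d) (l2shift c + d) <=
    2 * (l2_ip c c + l2_ip (l2shift d) (l2shift d)).
Proof.
move=> d0; apply: l2_ip_le => n.
pose F j := if (j < m)%N then 0 else c (j - m)%N ^+ 2 * (v (j - m)%N)%:num.
(* Partial sums of length n + m are needed because the shift delays the first n terms of [c] and [d]
   by [m]. *)
apply: (@le_trans _ _ (2 * (series F (n + m)%N + wsum (l2shift d) (n + m)%N))).
  rewrite wsum_shift.
  apply: (@le_trans _ _ (2 * (series F n +
      series (fun j => d j ^+ 2 * (v (j + m)%N)%:num) n))).
    rewrite /wsum /series /= -big_split mulr_sumr; apply: ler_sum => j _ /=.
    rewrite !fctE /= /F /shift; case: ltnP => [jm|mj].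
      by rewrite d0 // addr0 expr0n !mul0r addr0 mulr0.
    apply: weighted_parallelogram => //.
    by have := v_conc (j - m); rewrite !subnK.
  rewrite ler_wpM2l // lerD2r; apply: nondecreasing_series; last exact: leq_addr.
  by move=> j _ _; rewrite /F; case: ifP => // _; rewrite mulr_ge0 // sqr_ge0.
by rewrite /F (series_shift (fun i => c i ^+ 2 * (v i)%:num)) ler_wpM2l // lerD // wsum_le_l2_ip.
Qed.

(** Each shift raises the order of vanishing by at least 1; this provides purity. *)
Lemma iter_l2shift_eq0 n (c : l2) j : (j < n)%N -> iter n l2shift c j = 0.
Proof.
elim: n j => [//|n IH] j jn; rewrite iterS /= /shift; case: ltnP => // mj.
by apply: IH; lia.
Qed.

Lemma l2_wandering (N N' : set l2) :
  subspace N -> ip_closed l2_ip N -> (forall c : l2, N c -> N (l2shift c)) ->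
  subspace N' -> ip_closed l2_ip N' -> (forall c : l2, N' c -> N' (l2shift c)) ->
  (forall c : l2, N c -> forall j, (j < m)%N -> c j = 0) ->
  (forall e, N e -> (forall c : l2, N c -> l2_ip e (l2shift c) = 0) -> N' e) ->
  N `<=` N'.
Proof.
move=> Nsub Ncl NT N'sub N'cl N'T Nm EN'.
apply: (wandering_subspace_of_shimorin l2_ipC l2_ipDl l2_ipZl l2_ip_ge0 l2_ip_eq0 l2_complete
  l2shift_linear) => //.
- by move=> c; apply: l2_ip_le => n; exact: le_trans (wsum_shift_le _ _) (wsum_le_l2_ip _ _).
- by move=> c d _ Nd; apply: l2shift_shimorin; exact: Nm.
- move=> c _ cT; apply/val_inj/funext => j.
  by have [d ->] := cT j.+1; exact: iter_l2shift_eq0.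
Qed.

End Shift.
End WeightedL2.

(** * Complex series *)

Section ComplexSeries.
Variable R : realType.
Implicit Types (u : nat -> Cplx R) (l z : Cplx R).
Local Notation Re := (@complex.Re R).
Local Notation Im := (@complex.Im R).
Local Notation normc := (@Normc.normc R).

Lemma normc2 (z : R[i]%C) : normc z ^+ 2 = Re z ^+ 2 + Im z ^+ 2.
Proof. by case: z => x y; rewrite /= sqr_sqrtr // addr_ge0 // sqr_ge0. Qed.

Lemma normc_ge0 (z : R[i]%C) : 0 <= normc z.
Proof. by case: z => x y; rewrite /= sqrtr_ge0. Qed.

Lemma normCE z : `|z| = ((normc z)%:C)%C.
Proof. by []. Qed.

Lemma normr_Re_le (z : R[i]%C) : `|Re z| <= normc z.
Proof.
rewrite -(ler_pXn2r (ltn0Sn 1)) ?nnegrE ?normc_ge0 // normc2 real_normK ?num_real //.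
by rewrite lerDl sqr_ge0.
Qed.

Lemma normr_Im_le (z : R[i]%C) : `|Im z| <= normc z.
Proof.
rewrite -(ler_pXn2r (ltn0Sn 1)) ?nnegrE ?normc_ge0 // normc2 real_normK ?num_real //.
by rewrite lerDr sqr_ge0.
Qed.

Lemma normc_le_ReIm (z : R[i]%C) : normc z <= `|Re z| + `|Im z|.
Proof.
rewrite -(ler_pXn2r (ltn0Sn 1)) ?nnegrE ?normc_ge0 ?addr_ge0 // normc2.
by rewrite sqrrD !real_normK ?num_real // lerD2r lerDl mulrn_wge0 // mulr_ge0.
Qed.

Lemma ReD (x y : R[i]%C) : Re (x + y) = Re x + Re y.
Proof. by case: x => ? ?; case: y. Qed.
Lemma ImD (x y : R[i]%C) : Im (x + y) = Im x + Im y.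
Proof. by case: x => ? ?; case: y. Qed.
Lemma ReB (x y : R[i]%C) : Re (x - y) = Re x - Re y.
Proof. by case: x => ? ?; case: y. Qed.
Lemma ImB (x y : R[i]%C) : Im (x - y) = Im x - Im y.
Proof. by case: x => ? ?; case: y. Qed.

Lemma cvg_complexP u l :
  u @ \oo --> l <->
  (fun n => Re (u n)) @ \oo --> Re l /\ (fun n => Im (u n)) @ \oo --> Im l.
Proof.
split=> [/cvgrPdist_lt ul|[/cvgrPdist_lt rl /cvgrPdist_lt il]].
  split; apply/cvgrPdist_lt => e e0.
    have e0' : 0 < (e%:C)%C :> Cplx R by rewrite ltcR.
    apply: filterS (ul _ e0') => n; rewrite normCE ltcR.
    by rewrite -ReB; exact/le_lt_trans/normr_Re_le.
  have e0' : 0 < (e%:C)%C :> Cplx R by rewrite ltcR.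
  apply: filterS (ul _ e0') => n; rewrite normCE ltcR.
  by rewrite -ImB; exact/le_lt_trans/normr_Im_le.
apply/cvgrPdist_lt => -[e e'] e0.
(* A positive number in the complex order is real. *)
have [/eqP e'0 {}e0] : (e' == 0) /\ 0 < e.
  by move: e0; rewrite ltcE /= => /andP[].
rewrite {e'}e'0.
have e2 : 0 < e / 2 by lra.
apply: filterS2 (rl _ e2) (il _ e2) => n; rewrite -ReB -ImB => h1 h2.
rewrite normCE -[Complex _ _]/((e%:C)%C) ltcR.
apply: le_lt_trans (normc_le_ReIm _) _; lra.
Qed.

Lemma Re_series u n : Re (series u n) = series (fun j => Re (u j)) n.
Proof.
elim: n => [|n IH]; first by rewrite /series /= !big_nil.
by rewrite !seriesSr ReD IH.
Qed.

Lemma Im_series u n : Im (series u n) = series (fun j => Im (u j)) n.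
Proof.
elim: n => [|n IH]; first by rewrite /series /= !big_nil.
by rewrite !seriesSr ImD IH.
Qed.

Lemma cvg_complex_seriesP u l :
  series u @ \oo --> l <->
  series (fun j => Re (u j)) @ \oo --> Re l /\
  series (fun j => Im (u j)) @ \oo --> Im l.
Proof.
rewrite cvg_complexP.
rewrite (_ : (fun n => Re _) = series (fun j => Re (u j))); last first.
  by apply/funext => n; exact: Re_series.
by rewrite (_ : (fun n => Im _) = series (fun j => Im (u j))) //;
  apply/funext => n; exact: Im_series.
Qed.

Lemma is_cvg_complex_series u :
  cvgn (series (fun j => normc (u j))) -> exists l, series u @ \oo --> l.
Proof.
move=> ucvg.
have cRe : cvgn (series (fun j => Re (u j))).
  apply: normed_cvg; apply: series_le_cvg ucvg => j; first exact: normr_ge0.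
    exact: normc_ge0.
  exact: normr_Re_le.
have cIm : cvgn (series (fun j => Im (u j))).
  apply: normed_cvg; apply: series_le_cvg ucvg => j; first exact: normr_ge0.
    exact: normc_ge0.
  exact: normr_Im_le.
exists (Complex (limn (series (fun j => Re (u j)))) (limn (series (fun j => Im (u j))))).
by apply/cvg_complex_seriesP; split.
Qed.

(** Strong induction: once the earlier coefficients vanish, |e_m| r^m is the size of the tail beyond
    m, which is O(r^(m+1)); then r tends to 0. *)
Lemma power_series_eq0 (e : nat -> R) :
  (forall r : R, 0 < r -> r < 1 -> series (fun j => e j * r ^+ j) @ \oo --> (0 : R)) ->
  forall j, e j = 0.
Proof.
move=> er0.
have [B B0 eB] : exists2 B, 0 < B & forall j, `|e j| <= B * 2 ^+ j.
  have h0 : 0 < 2^-1 :> R by lra.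
  have h1 : 2^-1 < 1 :> R by lra.
  have : cvgn (series (fun j => e j * 2^-1 ^+ j)).
    by apply/cvg_ex; exists 0; exact: er0 h0 h1.
  move=> /cvg_series_cvg_0 c0.
  have /cvg_has_ub[B ubB] : cvgn (fun j => e j * 2^-1 ^+ j).
    by apply/cvg_ex; exists 0.
  have lB j : `|e j| <= B * 2 ^+ j.
    have : `|e j * 2^-1 ^+ j| <= B by apply: ubB; exists j.
    by rewrite normrM normrX (ger0_norm (ltW h0)) exprVn ler_pdivrMr // exprn_gt0.
  exists (B + 1).
    have := le_trans (normr_ge0 _) (lB 0%N); rewrite expr0; lra.
  move=> j; apply: le_trans (lB j) _; rewrite ler_wpM2r ?exprn_ge0 //; lra.
pose tail (r : R) m := series (fun j => if (j <= m)%N then 0 else e j * r ^+ j).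
have tail_le (r : R) m n : 0 < r -> r <= 4^-1 -> `|tail r m n| <= 2 * B * (2 * r) ^+ m.+1.
  move=> r0 r4; have q0 : 0 < 2 * r by lra.
  (* Subtracting the remaining geometric tail makes the induction on [n] telescope, as 2 r <=
     1/2. *)
  suff : `|tail r m n| <= 2 * B * ((2 * r) ^+ m.+1 - (2 * r) ^+ maxn n m.+1).
    move=> /le_trans; apply; rewrite ler_wpM2l //; first lra.
    by rewrite gerBl exprn_ge0 // ltW.
  elim: n => [|n IH]; first by rewrite /tail /series /= big_nil max0n normr0 subrr mulr0.
  rewrite /tail seriesSr -/(tail r m n); case: leqP => nm.
    rewrite addr0 (maxn_idPr _) ?ltnS //.
    by move: IH; rewrite (maxn_idPr _) // ltnW // ltnS.
  move: IH; rewrite !(maxn_idPl _) // 1?ltnW // => IH.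
  apply: le_trans (ler_normD _ _) _; apply: le_trans (lerD IH (lexx _)) _.
  have t : `|e n * r ^+ n| <= B * (2 * r) ^+ n.
    rewrite normrM normrX (ger0_norm (ltW r0)) exprMn mulrA ler_wpM2r //.
    by rewrite exprn_ge0 // ltW.
  apply: le_trans (lerD (lexx _) t) _; rewrite exprS [(2 * r) ^+ n.+1]exprS.
  have : 0 <= B * (2 * r) ^+ n by rewrite mulr_ge0 ?ltW // exprn_gt0.
  nra.
elim/ltn_ind => m IH.
have em (r : R) : 0 < r -> r <= 4^-1 -> `|e m| <= 4 * B * 2 ^+ m * r.
  move=> r0 r4.
  have tail_cvg : tail r m @ \oo --> - (e m * r ^+ m).
    have -> : tail r m = series (fun j => e j * r ^+ j) -
                        series (fun j => if j == m then e m * r ^+ m else 0).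
      rewrite -seriesN -seriesD; congr series; apply/funext => j; rewrite !fctE.
      case: (ltngtP j m) => [jm||->]; rewrite ?subr0 ?subrr //.
      by rewrite IH // mul0r.
    rewrite -[X in _ --> X]add0r; apply: cvgB; first by apply: er0; lra.
    apply: cvg_near_cst; exists m.+1 => // n /= mn.
    rewrite /series /= big_mkord (bigD1 (Ordinal mn)) //= eqxx big1 ?addr0 //.
    by move=> i; rewrite -val_eqE /= => /negbTE ->.
  have : `|e m * r ^+ m| <= 2 * B * (2 * r) ^+ m.+1.
    rewrite -normrN -(cvg_lim _ tail_cvg) // -lim_norm; last first.
      by apply/cvg_ex; eexists; exact: tail_cvg.
    apply: limr_le; first by apply: is_cvg_norm; apply/cvg_ex; eexists; exact: tail_cvg.
    by apply: nearW => n; exact: tail_le.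
  rewrite normrM normrX (ger0_norm (ltW r0)) exprMn [r ^+ m.+1]exprS [2 ^+ m.+1]exprS.
  rewrite (_ : 2 * B * _ = (4 * B * 2 ^+ m * r) * r ^+ m); last by ring.
  by rewrite ler_pM2r // exprn_gt0.
apply/eqP; rewrite -normr_eq0 eq_le normr_ge0 andbT; apply/ler_addgt0Pr => d d0.
rewrite add0r; pose K := 4 * B * 2 ^+ m + 4.
have K4 : 4 <= K by rewrite lerDr !mulr_ge0 // ?exprn_ge0 // ltW.
(* Then 4 B 2^m r <= K r <= d; the summand 4 in [K] keeps it positive. *)
pose r := Num.min 4^-1 (d / K).
have r0 : 0 < r by rewrite lt_min divr_gt0 ?andbT //; lra.
have r4 : r <= 4^-1 by rewrite ge_min lexx.
apply: le_trans (em _ r0 r4) _.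
have : r <= d / K by rewrite ge_min lexx orbT.
rewrite ler_pdivlMr; last lra.
apply: le_trans; rewrite mulrC ler_wpM2l ?(ltW r0) // /K; lra.
Qed.
End ComplexSeries.

(** * Taylor coefficients and weights *)

Section Taylor.
Variable R : realType.
Implicit Types (f g : discfun R) (a b : nat -> Cplx R).

Lemma is_taylor_comb (x : Cplx R) f g a b : is_taylor f a -> is_taylor g b ->
  is_taylor (x *: f + g) (fun j => x * a j + b j).
Proof.
move=> fa gb z; rewrite !fctE.
have -> : series (fun j => (x * a j + b j) * \val z ^+ j) =
    x *: series (fun j => a j * \val z ^+ j) + series (fun j => b j * \val z ^+ j).
  rewrite -seriesZ -seriesD; congr series; apply/funext => j; rewrite !fctE mulrDl.
  by rewrite -mulrA.
apply: cvgD; last exact: gb.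
by apply: cvgZr; exact: fa.
Qed.

Lemma is_taylor_mulz k f a : is_taylor f a ->
  is_taylor (mulz k f) (fun j => if (j < k)%N then 0 else a (j - k)%N).
Proof.
move=> fa z; rewrite /mulz -(cvg_shiftn k).
have -> : (fun n => series (fun j => (if (j < k)%N then 0 else a (j - k)%N) * \val z ^+ j)
      (n + k)%N) = \val z ^+ k *: series (fun j => a j * \val z ^+ j).
  apply/funext; elim=> [|n IH].
    rewrite add0n [in RHS]/series !fctE /= big_nil scaler0.
    by rewrite /series /= big_nat big1 // => j /andP[_ ->]; rewrite mul0r.
  rewrite addSn seriesSr IH [in RHS]fctE seriesSr ltnNge leq_addl /= addnK scalerDr !fctE.
  congr (_ + _); rewrite exprD.

  by rewrite -[RHS]/(_ * _); ring.
by apply: cvgZr; exact: fa.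
Qed.

Lemma is_taylor_unique f g a : is_taylor f a -> is_taylor g a -> f = g.
Proof.
move=> fa ga; apply/funext => z.
by rewrite -(cvg_lim _ (fa z)) // -(cvg_lim _ (ga z)).
Qed.

(** The difference expands 0. At real points of the disc its real and imaginary parts are real power
    series vanishing on (0, 1). *)
Lemma taylor_coeff_unique f a b : is_taylor f a -> is_taylor f b -> a = b.
Proof.
move=> fa fb; have := @is_taylor_comb (-1) _ _ _ _ fa fb.
rewrite scaleN1r addNr => f0.
suff h j : -1 * a j + b j = 0.
  by apply/funext => j; have /eqP := h j; rewrite mulN1r addrC subr_eq0 => /eqP.
have real_eq (r : R) : 0 < r -> r < 1 ->
    series (fun j => complex.Re (-1 * a j + b j) * r ^+ j) @ \oo --> (0 : R) /\
    series (fun j => complex.Im (-1 * a j + b j) * r ^+ j) @ \oo --> (0 : R).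
  move=> r0 r1; have zr : disc R (r%:C)%C.
    rewrite /disc /= normCE -[1]/(((1 : R)%:C)%C) ltcR /= expr0n addr0 sqrtr_sqr.
    by rewrite ger0_norm // ltW.
  have /cvg_complex_seriesP := f0 (SigSub (mem_set zr)).
  have rX (w : R[i]%C) i : (complex.Re (w * (r%:C)%C ^+ i) = complex.Re w * r ^+ i) *
      (complex.Im (w * (r%:C)%C ^+ i) = complex.Im w * r ^+ i).
    by rewrite -rmorphXn; case: w => x y; rewrite /= !mulr0 subr0 add0r.
  rewrite /= => -[h1 h2]; split.
    by move: h1; under eq_fun do rewrite rX.
  by move: h2; under eq_fun do rewrite rX.
have Re0 := power_series_eq0 (fun r r0 r1 => (real_eq r r0 r1).1) j.
have Im0 := power_series_eq0 (fun r r0 r1 => (real_eq r r0 r1).2) j.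
by apply/eqP; rewrite eq_complex Re0 Im0 !eqxx.
Qed.

Lemma taylorP f a : is_taylor f a -> taylor f = a.
Proof.
move=> fa; apply: (taylor_coeff_unique _ fa).
by rewrite /taylor; case: xgetP => [b -> //|/(_ a)].
Qed.
End Taylor.

(** * Monotonicity and concavity of the reciprocal weights *)

Section Weight.
Variables (R : realType) (alpha : R).
Hypotheses (alpha_ge : -1 <= alpha) (alpha_le : alpha <= 0).

Lemma weight_gt0 j : 0 < weight alpha j.
Proof. exact: powR_gt0. Qed.

Lemma weightV j : (weight alpha j)^-1 = j.+1%:R `^ (- alpha).
Proof. by rewrite powRN. Qed.

Lemma weight_noninc i j : (i <= j)%N -> weight alpha j <= weight alpha i.
Proof.
move=> ij; rewrite -[leLHS]invrK -[leRHS]invrK lef_pV2 ?posrE ?invr_gt0 ?weight_gt0 //.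
rewrite !weightV; apply: ge0_ler_powR; rewrite ?nnegrE ?oppr_ge0 //.
by rewrite ler_nat ltnS.
Qed.

(** This linear growth makes the power series converge on the disc in [synth_taylor]. *)
Lemma weightV_le j : (weight alpha j)^-1 <= j.+1%:R.
Proof.
rewrite weightV -[leRHS]powRr1 //; apply: ler_powR; first by rewrite ler1n.
by rewrite lerNl.
Qed.

(** The concave function t^b lies below its tangent at [x]. *)
Lemma powR_le_tangent (x y b : R) : 0 < x -> 0 < y -> 0 <= b -> b <= 1 ->
  y `^ b <= x `^ b * (1 - b + b * (y / x)).
Proof.
move=> x0 y0 b0 b1; have yx0 : 0 < y / x by exact: divr_gt0.
have -> : y `^ b = x `^ b * (y / x) `^ b.
  by rewrite -powRM ?ltW // mulrC divfK // gt_eqF.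
rewrite ler_wpM2l ?powR_ge0 //.
rewrite /powR (gt_eqF yx0); set L := ln _.
rewrite -[y / x in leRHS]lnK ?posrE // -/L.
(* Weighted by 1 - b and b, these lower bounds add up to 1; multiplying by exp(b L) gives exp(b L)
   <= 1 - b + b exp(L). *)
have h1 := expR_ge1Dx (- (b * L)); have h2 := expR_ge1Dx ((1 - b) * L).
have E0 := expR_gt0 (b * L).
have -> : expR L = expR (b * L) * expR ((1 - b) * L) by rewrite -expRD; congr expR; ring.
have EG : expR (b * L) * expR (- (b * L)) = 1 by rewrite -expRD subrr expR0.
have b1' : 0 <= 1 - b by rewrite subr_ge0.
have := ler_wpM2l (ltW E0) (lerD (ler_wpM2l b1' h1) (ler_wpM2l b0 h2)).
move: EG; move: (expR _) (expR (- _)) (expR ((1 - b) * L)) => E G F EG.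
rewrite (_ : (1 - b) * _ + _ = 1); last by ring.
rewrite mulr1 mulrDr (mulrCA E (1 - b)) EG; lra.
Qed.

(** Both outer values are bounded by the tangent at the middle index, and the linear terms
    cancel. *)
Lemma weightV_concave i k :
  (weight alpha i)^-1 + (weight alpha (i + k + k))^-1 <= 2 * (weight alpha (i + k))^-1.
Proof.
rewrite !weightV; set b := - alpha.
have [b0 b1] : 0 <= b /\ b <= 1 by rewrite /b oppr_ge0 lerNl.
pose x : R := (i + k).+1%:R.
have x0 : 0 < x by rewrite ltr0n.
have h1 := powR_le_tangent x0 (ltr0Sn R i) b0 b1.
have h2 := powR_le_tangent x0 (ltr0Sn R (i + k + k)) b0 b1.
rewrite -/x; apply: le_trans (lerD h1 h2) _; rewrite -mulrDr mulrC ler_wpM2r ?powR_ge0 //.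
have -> : (i + k + k).+1%:R = x + k%:R :> R by rewrite /x -natrD.
have -> : i.+1%:R = x - k%:R :> R by rewrite /x -addSn natrD addrK.
by rewrite le_eqVlt; apply/orP; left; apply/eqP; field; rewrite gt_eqF.
Qed.
End Weight.

(** * The spaces as real weighted l2 spaces *)

Section Realification.
Variables (R : realType) (alpha : R).
Hypotheses (alpha_ge : -1 <= alpha) (alpha_le : alpha <= 0).
Local Notation Re := (@complex.Re R).
Local Notation Im := (@complex.Im R).
Local Notation normc := (@Normc.normc R).

(* A complex sequence a is encoded as Re a_0, Im a_0, Re a_1, Im a_1, ...: the
   inner product becomes its real part, and z^k a shift by 2k. *)
Definition rweight j : {posnum R} := PosNum (weight_gt0 alpha j./2).

Definition interleave (a : nat -> Cplx R) j : R :=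
  if odd j then Im (a j./2) else Re (a j./2).

Definition coef (c : nat -> R) : nat -> Cplx R :=
  fun j => Complex (c j.*2) (c j.*2.+1).

Lemma interleaveK a : coef (interleave a) = a.
Proof.
apply/funext => j; rewrite /coef /interleave /= odd_double /= doubleK uphalf_double.
by case: (a j).
Qed.

Lemma coefK c : interleave (coef c) = c.
Proof.
apply/funext => j; rewrite /coef /interleave.
by case: ifP => oj /=; rewrite -{2}(odd_double_half j) oj.
Qed.

Lemma series_double (f : nat -> R) n :
  series f n.*2 = series (fun j => f j.*2 + f j.*2.+1) n.
Proof.
elim: n => [|n IH]; first by rewrite /series /= !big_nil.
by rewrite doubleS !seriesSr IH addrA.
Qed.

Lemma wsum_double c n :
  wsum rweight c n.*2 = series (fun j => normc (coef c j) ^+ 2 * weight alpha j) n.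
Proof.
rewrite /wsum series_double; congr (series _ _); apply/funext => j.
by rewrite normc2 /= doubleK uphalf_double -mulrDl.
Qed.

Lemma cvg_double : (fun n => n.*2) @ \oo --> \oo.
Proof.
apply/cvgnyPge => A; exists A => // n /= An; rewrite -addnn.
exact: leq_trans An (leq_addr _ _).
Qed.

(** These are the partial sums of even length of the interleaved series, so the limit is the
    same. *)
Lemma l2_ip_double (c d : l2 rweight) :
  series (fun j => (Re (coef c j) * Re (coef d j) + Im (coef c j) * Im (coef d j))
     * weight alpha j) @ \oo --> l2_ip c d.
Proof.
rewrite (_ : series _ =
    series (fun j => c j * d j * (rweight j)%:num) \o (fun n => n.*2)); last first.
  apply/funext => n; rewrite /= series_double; congr (series _ _); apply/funext => j.
  by rewrite /= doubleK uphalf_double -mulrDl.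
by apply: cvg_comp; [exact: cvg_double | exact: l2_ip_cvg].
Qed.

Lemma normc_coef_series (c : l2 rweight) :
  series (fun j => normc (coef c j) ^+ 2 * weight alpha j) @ \oo --> l2_ip c c.
Proof.
under eq_fun do rewrite normc2 !expr2.
exact: l2_ip_double.
Qed.

(** The closed form bounds the partial sums by (1 - r)^(-2); it is used with r = |z|^2. *)
Lemma is_cvg_sq_geometric (r : R) : 0 <= r -> r < 1 ->
  cvgn (series (fun j => j.+1%:R * r ^+ j)).
Proof.
move=> r0 r1; apply: nondecreasing_is_cvgn.
  by apply: nondecreasing_series => n _ _; rewrite mulr_ge0 // exprn_ge0.
have closed_form n : (1 - r) ^+ 2 * series (fun j => j.+1%:R * r ^+ j) n =
    1 - r ^+ n * (1 + n%:R * (1 - r)).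
  elim: n => [|n IH]; first by rewrite /series /= big_nil; ring.
  by rewrite seriesSr mulrDr IH (exprS r n) -(natr1 n); ring.
exists ((1 - r) ^- 2) => _ [n _ <-].
have q0 : 0 < (1 - r) ^+ 2 by rewrite exprn_gt0 // subr_gt0.
rewrite -[leRHS]mulr1 ler_pdivlMl // closed_form gerBl mulr_ge0 ?exprn_ge0 //.
by rewrite addr_ge0 // mulr_ge0 // subr_ge0 ltW.
Qed.

(** The lemmas below make this a real-linear isometry onto [spaceD alpha]; [synth_taylor] shows that
    the limit is genuine. *)
Definition synth (c : l2 rweight) : discfun R :=
  fun z => limn (series (fun j => coef c j * \val z ^+ j)).

Lemma normcX (z : R[i]%C) n : normc (z ^+ n) = normc z ^+ n.
Proof.
elim: n => [|n IH]; first exact: Normc.normc1.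
by rewrite !exprS Normc.normcM IH.
Qed.

Lemma synth_taylor (c : l2 rweight) : is_taylor (synth c) (coef c).
Proof.
move=> z; pose u : nat -> Cplx R := fun j => coef c j * \val z ^+ j.
rewrite -/u.
suff [l ul] : exists l : Cplx R, series u @ \oo --> l.
  by rewrite /synth -/u (cvg_lim _ ul).
apply: is_cvg_complex_series.
have z1 : normc (\val z) < 1.
  by have /set_mem := valP z; rewrite /disc /= normCE -[1]/(((1 : R)%:C)%C) ltcR.
have zz : normc (\val z) ^+ 2 < 1 by rewrite expr_lt1 // normc_ge0.
apply: (@series_le_cvg _ _
  ((fun j => normc (coef c j) ^+ 2 * weight alpha j) +
   (fun j => j.+1%:R * (normc (\val z) ^+ 2) ^+ j))).
- by move=> j; exact: normc_ge0.
- move=> j; rewrite fctE addr_ge0 // mulr_ge0 //; last by rewrite exprn_ge0 // sqr_ge0.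
    exact: sqr_ge0.
  by rewrite ltW // weight_gt0.
- move=> j; rewrite fctE /u Normc.normcM normcX exprAC.
  have w0 := weight_gt0 alpha j; have wV := weightV_le alpha_ge j.
  move: (normc (coef c j)) (normc (\val z) ^+ j) => x y.
  have : y ^+ 2 * (weight alpha j)^-1 <= j.+1%:R * y ^+ 2.
    by rewrite mulrC ler_wpM2r ?sqr_ge0.
  (* With w the weight, 2 x y <= x^2 w + y^2 / w, so |a_j z^j| is dominated by |a_j|^2 w_j + (j + 1)
     |z|^(2j). *)
  have : 0 <= (x * weight alpha j - y) ^+ 2 / weight alpha j.
    by rewrite mulr_ge0 ?sqr_ge0 // invr_ge0 ltW.
  have -> : (x * weight alpha j - y) ^+ 2 / weight alpha j =
     x ^+ 2 * weight alpha j - 2 * (x * y) + y ^+ 2 * (weight alpha j)^-1.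
    by field; rewrite gt_eqF.
  have := mulr_ge0 (sqr_ge0 x) (ltW w0).
  have : 0 <= y ^+ 2 * (weight alpha j)^-1 by rewrite mulr_ge0 ?sqr_ge0 // invr_ge0 ltW.
  lra.
- apply: is_cvg_seriesD.
    by apply/cvg_ex; eexists; exact: normc_coef_series.
  by apply: is_cvg_sq_geometric => //; rewrite sqr_ge0.
Qed.

Arguments synth_taylor : clear implicits.

Lemma taylor_synth (c : l2 rweight) : taylor (synth c) = coef c.
Proof. exact/taylorP/synth_taylor. Qed.

Lemma sqnormD_synth (c : l2 rweight) : sqnormD alpha (synth c) = (l2_ip c c)%:E.
Proof.
rewrite /sqnormD taylor_synth; apply: cvg_lim => //.
under eq_fun do rewrite sumEFin.
by apply: cvg_EFin; [exact: nearW | exact: normc_coef_series].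
Qed.

Lemma spaceD_synth (c : l2 rweight) : spaceD alpha (synth c).
Proof.
by split; [exists (coef c); exact: synth_taylor | rewrite sqnormD_synth ltry].
Qed.

Lemma synth_onto f : spaceD alpha f -> exists c, synth c = f.
Proof.
move=> [[a fa] fin]; have ta := taylorP fa.
have w0 j : 0 <= normc (a j) ^+ 2 * weight alpha j.
  by rewrite mulr_ge0 ?sqr_ge0 // ltW // weight_gt0.
have cl2 : interleave a \in l2_pred rweight.
  apply/asboolP; exists (fine (sqnormD alpha f)) => n.
  (* Passing to length 2n pairs every real part with its imaginary part. *)
  apply: le_trans (wsum_nondecreasing _ _ (leq_addr n n)) _.
  rewrite addnn wsum_double interleaveK -lee_fin fineK; last first.
    rewrite ge0_fin_numE //; apply: nneseries_ge0 => j _ _.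
    by rewrite lee_fin ta.
  rewrite /sqnormD ta /series /= -sumEFin.
  by apply: nneseries_lim_ge => j _; rewrite lee_fin.
exists (L2 cl2); apply: (is_taylor_unique _ fa).
by rewrite -{2}(interleaveK a); exact: synth_taylor.
Qed.

Lemma synth_inj : injective synth.
Proof.
move=> c d cd; have := taylor_synth c; rewrite cd taylor_synth => e.
by apply/val_inj; rewrite /= -(coefK c) -(coefK d) e.
Qed.

Lemma synth_linear (r : R) (c d : l2 rweight) :
  synth (r *: c + d) = (r%:C)%C *: synth c + synth d.
Proof.
apply/esym; apply: (is_taylor_unique (is_taylor_comb (synth_taylor c) (synth_taylor d))).
rewrite (_ : (fun j => _) = coef (r *: c + d)); first exact: synth_taylor.
apply/funext => j; apply/eqP; rewrite eq_complex /= !mul0r subr0 addr0.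
by rewrite !eqxx.
Qed.

Lemma synth0 : synth 0 = (fun=> 0).
Proof.
have := synth_linear (-1) 0 0.
by rewrite scaler0 addr0 rmorphN rmorph1 scaleN1r addNr.
Qed.

Lemma normD_synth (c d : l2 rweight) :
  normD alpha (synth c - synth d) = Num.sqrt (l2_ip (c - d) (c - d)).
Proof.
rewrite (_ : synth c - synth d = synth (c - d)) /normD ?sqnormD_synth //.
rewrite (_ : c - d = -1 *: d + c); last by rewrite scaleN1r addrC.
by rewrite synth_linear rmorphN rmorph1 scaleN1r addrC.
Qed.

(** * Multiplication by z^k as a shift by 2k real coordinates *)

Section MulZ.
Variable k : nat.

Lemma rweight_noninc j : (rweight (j + k.*2)%N)%:num <= (rweight j)%:num.
Proof. by apply: weight_noninc => //; apply: half_leq; exact: leq_addr. Qed.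

Lemma half_add_double i : (i + k.*2)./2 = (i./2 + k)%N.
Proof. by rewrite halfD odd_double andbF doubleK. Qed.

Lemma rweight_conc j : (rweight j)%:num^-1 + (rweight (j + k.*2 + k.*2)%N)%:num^-1 <=
  2 * (rweight (j + k.*2)%N)%:num^-1.
Proof. by rewrite /= !half_add_double; exact: weightV_concave. Qed.

Lemma mulz_synth (c : l2 rweight) : mulz k (synth c) = synth (l2shift rweight_noninc c).
Proof.
have h := is_taylor_mulz (k := k) (synth_taylor c).
apply: (is_taylor_unique h).
rewrite (_ : (fun j => _) = coef (l2shift rweight_noninc c)); first exact: synth_taylor.
apply/funext => j; rewrite /coef /= /shift ltn_double ltn_Sdouble.
case: ltnP => // kj; rewrite doubleB subSn //.
by rewrite leq_double.
Qed.
End MulZ.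

(** The imaginary part of the Hermitian product with y is the real product with i y. *)
Lemma conj_term (x y : Cplx R) (w : R) :
  (Re (x * y^* * (w%:C)%C) = (Re x * Re y + Im x * Im y) * w) *
  (Im (x * y^* * (w%:C)%C) = (Re x * Re ('i%C * y) + Im x * Im ('i%C * y)) * w).
Proof.
rewrite (_ : y^* = conjc y) //; case: x => a b; case: y => c d /=.
by split; ring.
Qed.

(** The real l2 space has no multiplication by i, so [d'] supplies i d; the two real orthogonalities
    are those of [conj_term]. *)
Lemma innerD_synth_eq0 (c d d' : l2 rweight) : synth d' = ('i%C : Cplx R) *: synth d ->
  l2_ip c d = 0 -> l2_ip c d' = 0 -> innerD alpha (synth c) (synth d) = 0.
Proof.
move=> dd' cd cd'.
have d'E j : coef d' j = 'i%C * coef d j.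
  have h := is_taylor_comb (x := 'i%C) (synth_taylor d) (synth_taylor 0).
  rewrite synth0 -[X in _ + X]/(0 : discfun R) addr0 -dd' in h.
  rewrite (taylor_coeff_unique (synth_taylor d') h) (_ : coef 0 j = 0) ?addr0 //.
rewrite /innerD !taylor_synth; apply: cvg_lim => //.
apply/cvg_complex_seriesP; split.
  by under eq_fun do rewrite conj_term; rewrite -[Re 0]cd; exact: l2_ip_double.
under eq_fun do rewrite conj_term -d'E.
by rewrite -[Im 0]cd'; exact: l2_ip_double.
Qed.

(** * Transfer of the wandering subspace property to the function space *)

Section Pullback.
Variable k : nat.
Hypothesis k_ge1 : (1 <= k)%N.
Let m_gt0 : (0 < k.*2)%N. Proof. by rewrite double_gt0. Qed.

Lemma pullback_subspace (N : set (discfun R)) :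
  linear_subspace N -> subspace (synth @^-1` N).
Proof.
move=> [N0 Nlin]; split; first by rewrite /preimage /= synth0.
by move=> r c d Nc Nd; rewrite /preimage /= synth_linear; exact: Nlin.
Qed.

Lemma pullback_closed (N : set (discfun R)) :
  closed_subspace alpha N -> ip_closed (@l2_ip _ _) (synth @^-1` N).
Proof.
move=> [_ _ Ncl] c cN; apply: Ncl; first exact: spaceD_synth.
(* [ip_closed] measures squared distances, hence the tolerance e^2. *)
move=> e e0; have [d Nd ce] := cN _ (exprn_gt0 2 e0).
exists (synth d) => //; rewrite normD_synth -(ger0_norm (ltW e0)) -sqrtr_sqr.
by rewrite ltr_sqrt // exprn_gt0.
Qed.

Lemma pullback_invariant (N : set (discfun R)) : Defs.invariant k N ->
  forall c : l2 rweight, N (synth c) -> N (synth (l2shift (rweight_noninc k) c)).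
Proof. by move=> Ninv c Nc; rewrite -mulz_synth; apply: Ninv; exists (synth c). Qed.

Lemma shift_wandering : wandering_subspace_property alpha k (mulz k @` spaceD alpha).
Proof.
move=> N Ncl NM Ninv; apply/seteqP; split; last first.
  (* The easy inclusion: [N] itself is closed, invariant and contains its wandering part. *)
  by apply: smallest_sub => [|f []].
have [Nsp Nlin _] := Ncl.
move=> f Nf N' [[N'cl N'inv] EN'].
have [_ N'lin _] := N'cl.
have [c cf] := synth_onto (Nsp _ Nf).
rewrite -cf; rewrite -cf in Nf; move: c Nf {cf}.
apply: (l2_wandering m_gt0 (rweight_conc k) (v_noninc := rweight_noninc k)
  (N := synth @^-1` N) (N' := synth @^-1` N')).
- exact: pullback_subspace.
- exact: pullback_closed.
- exact: pullback_invariant.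
- exact: pullback_subspace.
- exact: pullback_closed.
- exact: pullback_invariant.
(* Only here is [N] contained in z^k D_alpha used: the first 2k real coordinates vanish. *)
- move=> c /NM[g /synth_onto[d <-]]; rewrite mulz_synth => /synth_inj <- j jk.
  by rewrite /= /shift jk.
- move=> e Ne eT; apply: EN'; split=> // _ [h Nh <-].
  (* Real orthogonality to both z^k h and z^k (i h) gives the complex orthogonality required by
     [ominus]. *)
  have Nih : N (('i%C : Cplx R) *: h).
    by have := Nlin.2 'i%C _ _ Nh Nlin.1; rewrite -[X in _ + X]/(0 : discfun R) addr0.
  have [d dh] := synth_onto (Nsp _ Nh); have [d' dh'] := synth_onto (Nsp _ Nih).
  rewrite -dh mulz_synth.
  apply: (@innerD_synth_eq0 _ _ (l2shift (rweight_noninc k) d')).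
  + rewrite -!mulz_synth dh dh'; apply/funext => z.
    by rewrite /mulz !fctE -[RHS]/(_ * _) mulrCA.
  + by apply: eT; rewrite /preimage /= dh.
  + by apply: eT; rewrite /preimage /= dh'.
Qed.
End Pullback.
End Realification.

Theorem proposition3p6 (R : realType) (k : nat) (alpha : R)
    (k_ge1 : (1 <= k)%N) (alpha_ge : -1 <= alpha) (alpha_le : alpha <= 0) :
  wandering_subspace_property alpha k (mulz k @` spaceD alpha).
Proof. exact: shift_wandering. Qed.
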